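(* Let $d\geq 1$ be an integer. Let $D_1,R,\alpha$ be positive real numbers and let $M\geq 0$. For every $0\leq R'<R$ there are positive constants $D_2$ and $\beta$, depending only on $D_1,\alpha,R,R'$, and $M$, such that the following holds: if $f:\mathbf{R}^d\to\mathbf{C}$ satisfies $$|f(x)|\leq (1+|x|)^{-R}$$ for all $x\in\mathbf{R}^d$ and $$|f(x)-f(x')|\leq D_1|x-x'|^\alpha\bigl(1+\max(|x|,|x'|)\bigr)^M$$ for all $x,x'\in\mathbf{R}^d$, then $$|f(x)-f(x')|\leq D_2|x-x'|^\beta\bigl(1+\min(|x|,|x'|)\bigr)^{-R'}$$ for all $x,x'\in\mathbf{R}^d$.
   Context: $|x|$ denotes the Euclidean norm of $x\in\mathbf{R}^d$, and $|z|$ the modulus of $z\in\mathbf{C}$. Note that the hypothesis involves $\max(|x|,|x'|)$ while the conclusion involves $\min(|x|,|x'|)$; this is intended. *)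

(* Defs.v *)
From mathcomp Require Import all_boot all_order all_algebra.
From mathcomp Require Import complex.
From mathcomp Require Import reals exp.

Set Implicit Arguments.
Unset Strict Implicit.
Unset Printing Implicit Defensive.

Import Order.TTheory GRing.Theory Num.Theory.

Local Open Scope ring_scope.

(* The canonical norm on 'rV[K]_d is the sup norm, hence this definition.  The
   modulus on K[i] is [Normc.normc], which is K-valued, whereas the canonical
   norm on K[i] takes its values in K[i]. *)
Definition euclid_norm (K : realType) (d : nat) (x : 'rV[K]_d) : K :=
  Num.sqrt (\sum_(i < d) x 0 i ^+ 2).

(* Main.v *)
(** For |x - x'| >= 1 the decay hypothesis alone suffices. For |x - x'| < 1 the
    triangle inequality gives 1 + max <= 2 (1 + min), and the two hypotheses
    bound |f x - f x'| by multiples of |x - x'|^alpha A^M and A^(-R), where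
    A = 1 + min; their geometric mean with weights theta and 1 - theta,
    theta = (R - R') / (R + M), has exponent exactly -R' in A and exponent
    beta = alpha theta in |x - x'|. *)
Require Import Defs.
From mathcomp Require Import all_boot all_order all_algebra.
From mathcomp Require Import complex.
From mathcomp Require Import reals exp.
From mathcomp Require Import ring lra.

Set Implicit Arguments.
Unset Strict Implicit.
Unset Printing Implicit Defensive.

Import Order.TTheory GRing.Theory Num.Theory.

Local Open Scope ring_scope.
Local Open Scope complex_scope.

(** Cauchy-Schwarz. With [s] and [t] the two norms and [S] the sum on the left, expanding the sum of
    the squares [(t * a i - s * b i) ^+ 2] gives [2 * (s * t) * (s * t - S)], so [S <= s * t] once
    [s * t] is positive; otherwise one family vanishes identically. *)
Lemma sum_mul_le_sqrt (K : rcfType) (I : finType) (a b : I -> K) :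
  \sum_i a i * b i <=
    Num.sqrt (\sum_i a i ^+ 2) * Num.sqrt (\sum_i b i ^+ 2).
Proof.
have sq_ge0 (c : I -> K) : 0 <= \sum_i c i ^+ 2.
  by apply: sumr_ge0 => i _; exact: sqr_ge0.
have sq0 (c : I -> K) : Num.sqrt (\sum_i c i ^+ 2) = 0 -> forall i, c i = 0.
  move=> /eqP; rewrite sqrtr_eq0 => c_le0 i; apply/eqP; rewrite -sqrf_eq0.
  have /psumr_eq0P-> // : \sum_i c i ^+ 2 = 0.
    by apply/le_anti; rewrite c_le0 sq_ge0.
  by move=> j _; exact: sqr_ge0.
set s := Num.sqrt (\sum_i a i ^+ 2); set t := Num.sqrt (\sum_i b i ^+ 2).
have s_ge0 : 0 <= s := sqrtr_ge0 _.
have t_ge0 : 0 <= t := sqrtr_ge0 _.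
have [st_gt0|st_le0] := ltP 0 (s * t); last first.
  suff -> : \sum_i a i * b i = 0 by exact: mulr_ge0.
  have /eqP : s * t = 0 by apply/le_anti; rewrite st_le0 mulr_ge0.
  rewrite mulf_eq0 => /orP[] /eqP /sq0 c0; apply: big1 => i _.
    by rewrite c0 mul0r.
  by rewrite c0 mulr0.
have : 0 <= \sum_i (t * a i - s * b i) ^+ 2.
  by apply: sumr_ge0 => i _; exact: sqr_ge0.
have -> : \sum_i (t * a i - s * b i) ^+ 2 =
    t ^+ 2 * \sum_i a i ^+ 2 + s ^+ 2 * \sum_i b i ^+ 2
    - 2 * (s * t) * \sum_i a i * b i.
  rewrite !mulr_sumr -sumrN -!big_split /=.
  by apply: eq_bigr => i _; ring.
rewrite -(sqr_sqrtr (sq_ge0 a)) -(sqr_sqrtr (sq_ge0 b)) -/s -/t.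
have -> (S : K) : t ^+ 2 * s ^+ 2 + s ^+ 2 * t ^+ 2 - 2 * (s * t) * S =
    (s * t) * ((s * t - S) * 2) by ring.
by rewrite pmulr_rge0 // pmulr_lge0 // subr_ge0.
Qed.

Lemma euclid_norm_ge0 (K : realType) (d : nat) (x : 'rV[K]_d) :
  0 <= euclid_norm x.
Proof. exact: sqrtr_ge0. Qed.

Lemma euclid_normN (K : realType) (d : nat) (x : 'rV[K]_d) :
  euclid_norm (- x) = euclid_norm x.
Proof. by congr Num.sqrt; apply: eq_bigr => i _; rewrite mxE sqrrN. Qed.

(** Both sides are compared as square roots; after squaring, only the cross term differs, and
    Cauchy-Schwarz bounds it. *)
Lemma euclid_normD (K : realType) (d : nat) (x y : 'rV[K]_d) :
  euclid_norm (x + y) <= euclid_norm x + euclid_norm y.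
Proof.
rewrite -[leRHS]ger0_norm ?addr_ge0 ?euclid_norm_ge0 // -sqrtr_sqr.
apply: ler_wsqrtr; rewrite sqrrD !sqr_sqrtr; first last.
- by apply: sumr_ge0 => i _; exact: sqr_ge0.
- by apply: sumr_ge0 => i _; exact: sqr_ge0.
have := sum_mul_le_sqrt (fun i => x 0 i) (fun i => y 0 i).
rewrite -/(euclid_norm x) -/(euclid_norm y) => CS.
have -> : \sum_(i < d) (x + y) 0 i ^+ 2 =
    \sum_(i < d) x 0 i ^+ 2 + (\sum_(i < d) x 0 i * y 0 i) *+ 2 +
    \sum_(i < d) y 0 i ^+ 2.
  by rewrite -sumrMnl -!big_split /=; apply: eq_bigr => i _; rewrite mxE sqrrD.
by rewrite lerD2r lerD2l lerMn2r.
Qed.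

Lemma euclid_norm_max_le (K : realType) (d : nat) (x y : 'rV[K]_d) :
  Num.max (euclid_norm x) (euclid_norm y) <=
    Num.min (euclid_norm x) (euclid_norm y) + euclid_norm (x - y).
Proof.
have := euclid_normD (x - y) y; rewrite subrK => xy.
have := euclid_normD (y - x) x; rewrite subrK -opprB euclid_normN => yx.
by case: (leP (euclid_norm x) (euclid_norm y)) => _; lra.
Qed.

Lemma powRN_le (K : realType) (a b r : K) :
  0 <= r -> 0 < a -> a <= b -> b `^ (- r) <= a `^ (- r).
Proof.
move=> r_ge0 a_gt0 ab; have b_gt0 := lt_le_trans a_gt0 ab.
rewrite !powRN lef_pV2 ?posrE ?powR_gt0 //.
by apply: ge0_ler_powR; rewrite // nnegrE ltW.
Qed.

Lemma le_powR_geo_mean (K : realType) (theta x a b : K) :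
  0 <= theta -> theta <= 1 -> 0 <= x -> x <= a -> x <= b ->
  x <= a `^ theta * b `^ (1 - theta).
Proof.
move=> th_ge0 th_le1 x_ge0 xa xb.
(* The exponents add up to 1, which is nonzero, so the splitting holds even at [x = 0]. *)
have -> : x = x `^ theta * x `^ (1 - theta).
  by rewrite -powRD addrC subrK ?powRr1 // oner_eq0.
by apply: ler_pM; rewrite ?powR_ge0 // ge0_ler_powR ?nnegrE ?subr_ge0 //;
  exact: le_trans x_ge0 _.
Qed.

Theorem theorem2 (K : realType) (D1 R alpha M R' : K)
    (D1_gt0 : 0 < D1) (R_gt0 : 0 < R) (alpha_gt0 : 0 < alpha) (M_ge0 : 0 <= M)
    (R'_ge0 : 0 <= R') (R'_ltR : R' < R) :
  exists D2 beta : K, 0 < D2 /\ 0 < beta /\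
    forall (d : nat) (d_ge1 : (1 <= d)%N) (f : 'rV[K]_d -> K[i]),
      (forall x : 'rV[K]_d,
         Normc.normc (f x) <= (1 + euclid_norm x) `^ (- R)) ->
      (forall x x' : 'rV[K]_d,
         Normc.normc (f x - f x') <=
           D1 * euclid_norm (x - x') `^ alpha
              * (1 + Num.max (euclid_norm x) (euclid_norm x')) `^ M) ->
      forall x x' : 'rV[K]_d,
        Normc.normc (f x - f x') <=
          D2 * euclid_norm (x - x') `^ beta
             * (1 + Num.min (euclid_norm x) (euclid_norm x')) `^ (- R').
Proof.
have RM_gt0 : 0 < R + M by lra.
pose theta := (R - R') / (R + M).
have th_gt0 : 0 < theta by rewrite divr_gt0 // subr_gt0.
have th_le1 : theta <= 1 by rewrite ler_pdivrMr //; lra.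
have thE : M * theta + - R * (1 - theta) = - R'.
  by rewrite /theta; field; rewrite gt_eqF.
clearbody theta.
pose C : K := (D1 * 2 `^ M) `^ theta * 2 `^ (1 - theta).
have C_ge0 : 0 <= C by rewrite mulr_ge0 ?powR_ge0.
(* The summand 2 serves distances at least 1, the summand [C] those below 1. The choice precedes [d]
   and [f], hence is uniform in both. *)
exists (2 + C), (alpha * theta); split; first by rewrite ltr_wpDr.
split=> [|d _ f f_decay f_holder x x']; first exact: mulr_gt0.
have := f_holder x x'; have := euclid_norm_max_le x x'.
have min_ge0 : 0 <= Num.min (euclid_norm x) (euclid_norm x').
  by rewrite le_min !euclid_norm_ge0.
have max_ge0 : 0 <= Num.max (euclid_norm x) (euclid_norm x').
  by rewrite le_max euclid_norm_ge0.
have decay : Normc.normc (f x - f x') <=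
    2 * (1 + Num.min (euclid_norm x) (euclid_norm x')) `^ (- R).
  have le1 (y : 'rV[K]_d) :
      Num.min (euclid_norm x) (euclid_norm x') <= euclid_norm y ->
      Normc.normc (f y) <=
        (1 + Num.min (euclid_norm x) (euclid_norm x')) `^ (- R).
    move=> le_y; apply: le_trans (f_decay y) _.
    by apply: powRN_le; rewrite ?lerD2l //; lra.
  apply: le_trans (le_normcD (f x) (- f x')) _; rewrite normcN.
  by rewrite mulr_natl mulr2n lerD ?le1 ?ge_min ?lexx ?orbT.
have n_ge0 : 0 <= Normc.normc (f x - f x').
  by case: (f x - f x') => u v; exact: sqrtr_ge0.
have r_ge0 := euclid_norm_ge0 (x - x').
(* What remains is an inequality between real numbers, so the norms are generalized to variables. *)
move: (Normc.normc _) (euclid_norm (x - x')) (Num.max _ _)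
  max_ge0 n_ge0 r_ge0 decay.
move: (Num.min _ _) min_ge0
  => m m_ge0 n r mx mx_ge0 n_ge0 r_ge0 decay mx_le holder.
have [r_ge1|r_lt1] := leP 1 r.
  (* Here [r] to the power beta is at least 1, and lowering the decay rate from [R] to [R'] only
     enlarges a power of [1 + m >= 1]. *)
  apply: le_trans decay _; apply: ler_pM; rewrite ?powR_ge0 //.
    rewrite -[leLHS]mulr1; apply: ler_pM => //; first by rewrite lerDl.
    by rewrite -(powRr0 r) ler_powR // ltW // mulr_gt0.
  by apply: ler_powR; lra.
(* Since [r < 1], [1 + mx <= 1 + m + r < 2 + m <= 2 * (1 + m)]. *)
have mx2_le : (1 + mx) `^ M <= (2 * (1 + m)) `^ M.
  by apply: ge0_ler_powR; rewrite ?nnegrE //; lra.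
have holder' : n <= D1 * r `^ alpha * (2 * (1 + m)) `^ M.
  by apply: le_trans holder _; rewrite ler_wpM2l // mulr_ge0 ?powR_ge0 // ltW.
have := le_powR_geo_mean (ltW th_gt0) th_le1 n_ge0 holder' decay.
have A_ge0 : 0 <= 1 + m by lra.
have -> : (D1 * r `^ alpha * (2 * (1 + m)) `^ M) `^ theta *
    (2 * (1 + m) `^ (- R)) `^ (1 - theta) =
    C * r `^ (alpha * theta) * (1 + m) `^ (- R').
  (* Splitting [- R'] by [thE] yields one power of [1 + m] for each factor of the mean; the rest is
     a rearrangement of products. *)
  rewrite -thE (@powRD _ (1 + m)); last first.
    by apply/implyP => _; rewrite gt_eqF //; lra.
  have D1_ge0 := ltW D1_gt0.
  have shuffle (a b c e g h : K) :
      a * b * (c * e) * (g * h) = a * c * g * b * (e * h) by ring.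
  rewrite /C !powRrM !powRM ?mulr_ge0 ?powR_ge0 //; exact: shuffle.
move=> n_le; apply: le_trans n_le _.
by rewrite ler_wpM2r ?powR_ge0 // ler_wpM2r ?powR_ge0 // lerDr.
Qed.
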